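(* Let $M=\{m_1,\dots,m_n\}$ and $W=\{w_1,\dots,w_n\}$, let $Q$ be a strategy with complete preference lists, and let $w\in W$. Algorithm $\mathcal{A}(Q,w)$ (described in the context) outputs the set $$N=\{m\in M \mid \exists\, Q'\in \mathcal{Q}_w \text{ such that } \mu_{Q'}[w]=m\},$$ and, for each $m\in N$, a list $Q(m,I;w)$ such that, for some partial list (tuple) $I$, $m$ is active in $Q(I;w)$.
   Context: A strategy $Q$ assigns to each man a complete strict preference list (a permutation) of $W$ and to each woman a complete strict preference list of $M$; $Q(a)$ denotes the list of person $a$. For a woman $w$ and a list $Q'(w)$, $(Q(-w),Q'(w))$ is the strategy obtained from $Q$ by replacing only $w$'s list by $Q'(w)$; $\mathcal{Q}_w$ is the family of all such strategies. $\mu_Q$ is the matching produced by the men-proposing Gale–Shapley algorithm (GS-M) on $Q$: a single man proposes to the top woman remaining on his list; a woman accepts if single, otherwise keeps the one she prefers (in her list) among her current partner and the proposer and rejects the other; a rejected man deletes that woman from his list; the process ends when no man is single. Whenever several men are single, the one with the smallest index proposes, so GS-M is deterministic; $\mu_Q$ is the man-optimal $Q$-stable matching. A man $m$ is active in a list $L$ of $w$ (with respect to $Q$) if $m$ proposes to $w$ during the run of GS-M on $(Q(-w),L)$. For a tuple (ordered sequence of distinct men) $I$, $Q(I;w)$ is the list obtained from $Q(w)$ by putting the men of $I$ at the front in the order of $I$, followed by the remaining men in their $Q(w)$ order; $Q(x,I;w)$ denotes $Q(J;w)$ where $J$ is $x$ followed by $I$. Algorithm $\mathcal{A}(Q,w)$: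 let $x_1$ be the first man to propose to $w$ in GS-M on $Q$; set $N=\{x_1\}$, $L=\{Q(x_1;w)\}$ and call $\mathbf{Explore}(Q(x_1;w))$. Procedure $\mathbf{Explore}$ applied to a list of $w$ whose first entry is $x$ and whose initial segment is the tuple $(x,I)$: run GS-M on $(Q(-w),Q(x,I;w))$ and let $A$ be the set of men who propose to $w$ after $x$'s proposal; for each $y\in A\setminus N$ (processed in turn, with $N$ updated as it grows), add $y$ to $N$, add $Q(y,x,I;w)$ to $L$, and call $\mathbf{Explore}(Q(y,x,I;w))$. Output $(N,L)$. *)

(* Defs.v *)
From mathcomp Require Import all_boot.
From mathcomp Require Import zify.

Set Implicit Arguments.
Unset Strict Implicit.
Unset Printing Implicit Defensive.

Notation man := ordinal (only parsing).
Notation woman := ordinal (only parsing).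

(* Preference lists are written from most to least preferred. *)
Record profile (n : nat) := Profile {
  mpref : {ffun man n -> seq (woman n)};
  wpref : {ffun woman n -> seq (man n)} }.

Definition complete n (l : seq 'I_n) : bool := perm_eq l (enum 'I_n).

Definition strategy n (Q : profile n) : Prop :=
  (forall m, complete (mpref Q m)) /\ (forall w, complete (wpref Q w)).

Definition replace n (Q : profile n) (w : woman n) (l : seq (man n)) :=
  Profile (mpref Q) [ffun v => if v == w then l else wpref Q v].

(* The family Q_w. *)
Definition strat_family n (Q : profile n) (w : woman n) (Q' : profile n) : Prop :=
  exists2 l, complete l & Q' = replace Q w l.

Definition prefers n (Q : profile n) (w : woman n) (m m' : man n) : bool :=
  index m (wpref Q w) < index m' (wpref Q w).

Record gs_state (n : nat) := GSState {
  remaining : {ffun man n -> seq (woman n)};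
  partner : {ffun woman n -> option (man n)};
  (* all proposals made so far, in chronological order *)
  trace : seq (man n * woman n) }.

Definition single n (s : gs_state n) (m : man n) : bool :=
  [forall w, partner s w != Some m].

Definition gs_init n (Q : profile n) : gs_state n :=
  GSState (mpref Q) [ffun=> None] [::].

Definition engage n (s : gs_state n) (w : woman n) (m : man n) :=
  [ffun v => if v == w then Some m else partner s v].

Definition delete n (s : gs_state n) (m : man n) (w : woman n) :=
  [ffun m' => if m' == m then rem w (remaining s m') else remaining s m'].

(* [enum 'I_n] is increasing, so the proposer is the single man of smallest
   index. With complete lists he never runs out of women (gs_no_single). *)
Definition gs_step n (Q : profile n) (s : gs_state n) : gs_state n :=
  if [seq m <- enum 'I_n | single s m] is m :: _ then
    if remaining s m is w :: _ then
      let t := rcons (trace s) (m, w) in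
      if partner s w is Some m' then
        if prefers Q w m m' then GSState (delete s m' w) (engage s w m) t
        else GSState (delete s m w) (partner s) t
      else GSState (remaining s) (engage s w m) t
    else s
  else s.

(* No man proposes twice to the same woman, hence n * n steps suffice. *)
Definition gs n (Q : profile n) : gs_state n :=
  iter (n * n) (gs_step Q) (gs_init Q).

Definition mu n (Q : profile n) (w : woman n) : option (man n) :=
  partner (gs Q) w.

Definition proposers n (Q : profile n) (w : woman n) : seq (man n) :=
  [seq p.1 | p <- trace (gs Q) & p.2 == w].

Definition active n (Q : profile n) (w : woman n) (l : seq (man n))
    (m : man n) : bool :=
  m \in proposers (replace Q w l) w.

(* Q(I; w) *)
Definition to_front n (Q : profile n) (w : woman n) (I : seq (man n)) :=
  I ++ [seq m <- wpref Q w | m \notin I].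

(* For J = (x, I): the men proposing to w after x in GS-M on
   (Q(-w), Q(J; w)). *)
Definition later_proposers n (Q : profile n) (w : woman n) (J : seq (man n)) :=
  let p := proposers (replace Q w (to_front Q w J)) w in
  if J is x :: _ then drop (index x p).+1 p else [::].

Definition output (n : nat) : Type := ({set man n} * seq (seq (man n)))%type.

(* The order in which a call of Explore goes through its set A is left
   unspecified by the algorithm: [order J] is the order used by the call on
   Q(J; w). No two calls of a run have the same J, so the functions [order]
   account for all possible runs. The recursion depth is bounded by [fuel]. *)
Fixpoint explore n (order : seq (man n) -> seq (man n)) (Q : profile n)
    (w : woman n) (fuel : nat) (J : seq (man n))
    (NL : output n) :=
  if fuel is k.+1 then
    foldl (fun (NL : output n) y =>
             if y \in NL.1 then NL
             else explore order Q w k (y :: J)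
                    (y |: NL.1, to_front Q w (y :: J) :: NL.2))
          NL [seq y <- order J | y \in later_proposers Q w J]
  else NL.

Definition algoA_fuel n (fuel : nat) (order : seq (man n) -> seq (man n))
    (Q : profile n) (w : woman n) : output n :=
  if proposers Q w is x1 :: _ then
    explore order Q w fuel [:: x1] ([set x1], [:: to_front Q w [:: x1]])
  else (set0, [::]).

(* The tuple J grows by a new man at each nested call, so depth n suffices
   (algoA_fuelE). *)
Definition algoA n := @algoA_fuel n n.

Lemma complete_uniq n (l : seq 'I_n) : complete l -> uniq l.
Proof. by move=> /perm_uniq->; exact: enum_uniq. Qed.
Lemma complete_mem n (l : seq 'I_n) x : complete l -> x \in l.
Proof. by move=> /perm_mem->; rewrite mem_enum. Qed.

Lemma foldl_output_ind n (P : output n -> Prop) f (s : seq 'I_n) a :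
  P a -> (forall a y, P a -> P (f a y)) -> P (foldl f a s).
Proof. by move=> Pa Pf; elim: s a Pa => //= y s IH a Pa; apply/IH/Pf. Qed.

Lemma explore_sub n order (Q : profile n) w k J (NL : output n) :
  NL.1 \subset (explore order Q w k J NL).1.
Proof.
elim: k J NL => //= k IH J NL; apply: (@foldl_output_ind _ (fun a => NL.1 \subset a.1)) => // a y sa.
case: ifP => // _; apply: (subset_trans sa); apply: subset_trans (IH _ _) => /=.
exact: subsetUr.
Qed.

Lemma explore_fuelS n order (Q : profile n) w k J (NL : output n) :
  n < k + size J -> uniq J -> {subset J <= NL.1} ->
  explore order Q w k.+1 J NL = explore order Q w k J NL.
Proof.
elim: k J NL => [|k IH] J NL lt uJ sJ.
  have := max_card (mem J); rewrite (card_uniqP uJ) card_ord => le.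
  by rewrite add0n ltnNge le in lt.
rewrite [LHS]/= [RHS]/=.
elim: [seq y <- _ | _] NL sJ => [//|y s IHs] NL sJ /=.
case: ifP => [_|yN]; first exact: IHs.
have yJ : y \notin J by apply/negP => /sJ; rewrite yN.
rewrite -/(explore order Q w k.+1 _ _) IH /=.
- apply: IHs => z zJ; apply: (subsetP (explore_sub _ _ _ _ _ _)).
  by rewrite inE sJ // orbT.
- by rewrite /= addnS -addSn.
- by rewrite yJ.
- by move=> z; rewrite !inE => /orP[->//|/sJ->]; rewrite orbT.
Qed.

Lemma algoA_fuelE n order (Q : profile n) w k :
  n <= k -> algoA_fuel k order Q w = algoA order Q w.
Proof.
move/subnK<-; elim: (k - n) => [//|d IH]; rewrite addSn -{}IH /algoA_fuel.
case: (proposers Q w) => // x _; apply: explore_fuelS => //=; first by lia.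
by move=> z; rewrite !inE.
Qed.

(* Bounds the number of steps left: it drops by one at each proposal. *)
Definition gs_weight n (s : gs_state n) (m : 'I_n) := size (remaining s m) - ~~ single s m.

Definition gs_inv n (s : gs_state n) :=
  [/\ forall m, uniq (remaining s m),
      forall w m, partner s w = Some m -> ohead (remaining s m) = Some w
    & forall m w, w \notin remaining s m -> partner s w <> None].

Lemma ltn_sum_at n (F G : 'I_n -> nat) (a : 'I_n) :
 (forall m, m != a -> F m = G m) -> F a < G a -> \sum_m F m < \sum_m G m.
Proof.
move=> h l; rewrite (bigD1 a) //= [X in _ < X](bigD1 a) //=.
by rewrite (eq_bigr G) ?ltn_add2r // => m /h.
Qed.

Lemma singlePn n (s : gs_state n) m : reflect (exists w, partner s w = Some m) (~~ single s m).
Proof.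
rewrite negb_forall; apply: (iffP existsP) => -[w]; first by rewrite negbK => /eqP; exists w.
by move=> e; exists w; rewrite negbK; apply/eqP.
Qed.

Lemma gs_step_inv n (Q : profile n) s :
  gs_inv s -> gs_inv (gs_step Q s) /\
  (gs_step Q s = s \/ \sum_m gs_weight (gs_step Q s) m < \sum_m gs_weight s m).
Proof.
move=> I; have [u h d] := I; rewrite /gs_step.
case e: [seq _ <- _ | _] => [|m l]; first by split; last left.
have sm : single s m.
  have : m \in [seq m <- enum 'I_n | single s m] by rewrite e inE eqxx.
  by rewrite mem_filter => /andP[].
case er: (remaining s m) => [|w r]; first by split; last left.
have nm v : partner s v <> Some m by move=> /eqP; apply/negP; move/forallP: sm.
case ep: (partner s w) => [m'|].
  have hm' := h _ _ ep.
  have mm' : m' != m by apply/eqP => E; case: (nm w); rewrite ep E.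
  case: ifP => _; split.
  - split=> [m1|w1 m1|m1 w1] /=.
    + by rewrite ffunE; case: ifP => // _; exact: rem_uniq.
    + rewrite !ffunE; case: eqP => [->[<-]|/eqP nw hp].
        by rewrite eq_sym (negbTE mm') er.
      case: eqP => [E|_]; last exact: h.
      by move: nw (h _ _ hp); rewrite E hm' => /eqP nw [E']; case: nw.
    + rewrite !ffunE; case: (w1 =P w) => [_ _ ? //|/eqP nw]; case: eqP => [->|_]; last exact: d.
      by rewrite mem_rem_uniq // inE nw /= => /d.
  - right.
    apply: (@ltn_sum_at _ _ _ m) => [m1 nm1|]; last first.
      rewrite /gs_weight /= ffunE eq_sym (negbTE mm') er sm.
      have -> : single (GSState (delete s m' w) (engage s w m) (rcons (trace s) (m, w))) m = false.
        by apply/negbTE/singlePn; exists w; rewrite /= ffunE eqxx.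
      by rewrite /=; lia.
    rewrite /gs_weight /= ffunE; case: eqP => [E|/eqP nE].
      subst m1.
      have -> : single s m' = false by apply/negbTE/singlePn; exists w.
      have -> : single (GSState (delete s m' w) (engage s w m) (rcons (trace s) (m, w))) m'.
        apply/forallP => v /=; rewrite ffunE; case: (v =P w) => [_|nv].
          by apply/eqP => -[E]; move: nm1; rewrite E eqxx.
        by apply/eqP => /h; rewrite hm' => -[E]; apply: nv.
      rewrite size_rem /=; first by lia.
      by case: (remaining s m') hm' => //= a ? [->]; rewrite inE eqxx.
    congr (_ - ~~ _); apply/forallP/forallP => H v; have := H v; rewrite /= ffunE.
      case: (v =P w) => // -> _; rewrite ep; apply/eqP => -[E].
      by move: nE; rewrite E eqxx.
    by case: (v =P w) => // _ _; apply/eqP => -[E]; move: nm1; rewrite E eqxx.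
  - split=> [m1|w1 m1|m1 w1] /=.
    + by rewrite ffunE; case: ifP => // _; exact: rem_uniq.
    + rewrite ffunE => hp; case: eqP => [E|_]; last exact: h.
      by case: (nm w1); rewrite hp E.
    + rewrite ffunE; case: eqP => [->|_]; last exact: d.
      rewrite mem_rem_uniq // inE negb_and negbK => /orP[/eqP->|/d//].
      by rewrite ep.
  - right; apply: (@ltn_sum_at _ _ _ m) => [m1 nm1|]; rewrite /gs_weight /= ffunE.
      by rewrite (negbTE nm1).
    have -> : single (GSState (delete s m w) (partner s) (rcons (trace s) (m, w))) m by [].
    by rewrite eqxx er sm /= eqxx; lia.
- split.
  + split=> //= [w1 m1|m1 w1]; rewrite ffunE; case: (w1 =P w).
    * by move=> -> [<-]; rewrite er.
    * by move=> _; exact: h.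
    * by [].
    * by move=> _; exact: d.
  + right; apply: (@ltn_sum_at _ _ _ m) => [m1 nm1|]; rewrite /gs_weight /=; last first.
  have -> : single (GSState (remaining s) (engage s w m) (rcons (trace s) (m, w))) m = false.
    by apply/negbTE/singlePn; exists w; rewrite /= ffunE eqxx.
  by rewrite er sm /=; lia.
  congr (_ - ~~ _); apply/forallP/forallP => H v; have := H v; rewrite /= ffunE.
    by case: (v =P w) => // -> _; rewrite ep.
  by case: (v =P w) => // _ _; apply/eqP => -[E]; move: nm1; rewrite E eqxx.
Qed.

Lemma gs_no_single n (Q : profile n) m : strategy Q -> ~~ single (gs Q) m.
Proof.
case=> cm _.
have I0 : gs_inv (gs_init Q).
  split=> [m1|w1 m1|m1 w1] /=; last by rewrite complete_mem.
    exact: complete_uniq.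
  by rewrite ffunE.
have H k : let s := iter k (gs_step Q) (gs_init Q) in
    gs_inv s /\ (gs_step Q s = s \/ k + \sum_m gs_weight s m <= n * n).
  elim: k => [|k [I b]] /=.
    split=> //; right; rewrite add0n.
    apply: leq_trans (_ : \sum_(m : 'I_n) n <= _).
      apply: leq_sum => m1 _; rewrite /gs_weight /=.
      by rewrite (perm_size (cm _)) size_enum_ord leq_subr.
    by rewrite sum_nat_const card_ord.
  have [I' H] := gs_step_inv Q I; split=> //.
  case: b => [e|le]; first by left; rewrite !e.
  case: H => [E|lt]; [by left; rewrite !E | right].
  by apply: leq_trans le; rewrite addSn -addnS leq_add2l.
have [I fx] := H (n * n); rewrite -/(gs Q) in I fx.
have {}fx : gs_step Q (gs Q) = gs Q.
  case: fx => // le; have [_ [//|]] := gs_step_inv Q I; lia.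
have [_ h d] := I.
apply/negP => sm.
have : m \in [seq m <- enum 'I_n | single (gs Q) m] by rewrite mem_filter sm mem_enum.
move: fx; rewrite /gs_step; case e: [seq _ <- _ | _] => [//|a l].
have sa : single (gs Q) a.
  have : a \in [seq m <- enum 'I_n | single (gs Q) m] by rewrite e inE eqxx.
  by rewrite mem_filter => /andP[].
case er: (remaining _ _) => [|w r].
  move=> _ _.
  have hp w : partner (gs Q) w != None by apply/eqP/(d a); rewrite er.
  pose f w := odflt a (partner (gs Q) w).
  have fE w : partner (gs Q) w = Some (f w) by rewrite /f; case: (partner _ _) (hp w).
  have fi : injective f.
    move=> v w E; have := h _ _ (fE v); rewrite E (h _ _ (fE w)) => -[] //.
  have [g _ gK] := injF_bij fi.
  by move/forallP: sa => /(_ (g a)); rewrite fE gK eqxx.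
move/(congr1 (fun s => size (trace s))).
by case: (partner _ _) => [m'|]; [case: ifP => _|]; rewrite /= size_rcons => /eqP; rewrite eqn_leq ltnn.
Qed.

(* Main.v *)
Require Import Defs.
From mathcomp Require Import all_boot.
From mathcomp Require Import zify.

(* [w]'s list matters to GS-M only through comparisons between men who have
   already proposed to her. Hence moving an active man to the front of her list
   does not change the run until he proposes, and then he keeps [w]: every man
   put in [N] is attainable. Conversely, once [x] is at the front and proposes,
   the set of all proposals depends only on [x]. If [z] is the first man outside
   [N] to propose to [w] on some list, let [x] be her favourite earlier proposer
   (if none, [z] proposes first on [Q] too, so [z = x_1]): [z] still proposes
   when [x] is moved to the front, hence also on the list [Q(x, I; w)] explored
   by the algorithm, all of whose proposers are in [N]. *)

Set Implicit Arguments.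
Unset Strict Implicit.
Unset Printing Implicit Defensive.

(** * Runs of GS-M: single steps, traces and invariants *)

Definition gs_at n (Q : profile n) k := iter k (gs_step Q) (gs_init Q).

Definition proposals_to n (w : woman n) (s : gs_state n) :=
  [seq p.1 | p <- trace s & p.2 == w].

Variant gs_step_spec n (Q : profile n) (s : gs_state n) : gs_state n -> Prop :=
| GSIdle : gs_step_spec Q s s
| GSFirst m v r of single s m & remaining s m = v :: r & partner s v = None :
    gs_step_spec Q s
      (GSState (remaining s) (engage s v m) (rcons (trace s) (m, v)))
| GSAccept m v r m' of single s m & remaining s m = v :: r
    & partner s v = Some m' & prefers Q v m m' :
    gs_step_spec Q s
      (GSState (delete s m' v) (engage s v m) (rcons (trace s) (m, v)))
| GSReject m v r m' of single s m & remaining s m = v :: r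
    & partner s v = Some m' & ~~ prefers Q v m m' :
    gs_step_spec Q s
      (GSState (delete s m v) (partner s) (rcons (trace s) (m, v))).

Lemma gs_stepP n (Q : profile n) s : gs_step_spec Q s (gs_step Q s).
Proof.
rewrite /gs_step; case e: [seq _ <- _ | _] => [|m l]; first exact: GSIdle.
have sm : single s m.
  have : m \in [seq m <- enum 'I_n | single s m] by rewrite e inE eqxx.
  by rewrite mem_filter => /andP[].
case er: (remaining s m) => [|v r]; first exact: GSIdle.
case ep: (partner s v) => [m'|]; last exact: GSFirst er ep.
by case: ifP => [|/negbT] hp; [exact: GSAccept er ep hp | exact: GSReject er ep hp].
Qed.

Lemma trace_step n (Q : profile n) s :
  trace (gs_step Q s) = trace s \/
  exists m v r, [/\ trace (gs_step Q s) = rcons (trace s) (m, v), single s m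
                  & remaining s m = v :: r].
Proof.
case: (gs_stepP Q s) => [|m v r sm er _|m v r m' sm er _ _|m v r m' sm er _ _].
  by left.
all: by right; exists m, v, r.
Qed.

Lemma prefix_trace n (Q : profile n) j k :
  j <= k -> prefix (trace (gs_at Q j)) (trace (gs_at Q k)).
Proof.
move/subnK<-; elim: (k - j) => [|d IH]; first by rewrite add0n prefix_refl.
apply: (prefix_trans IH); rewrite addSn /gs_at /= -/(gs_at Q (d + j)).
have [->|[m [v [r [-> _ _]]]]] := trace_step Q (gs_at Q (d + j)).
  exact: prefix_refl.
exact: prefix_rcons.
Qed.

Lemma prefix_proposals n (Q : profile n) w j k :
  j <= k -> prefix (proposals_to w (gs_at Q j)) (proposals_to w (gs_at Q k)).
Proof.
move/(prefix_trace Q)/prefixP => [t e].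
by rewrite /proposals_to e filter_cat map_cat prefix_prefix.
Qed.

Lemma mem_proposals n (s : gs_state n) w m :
  (m \in proposals_to w s) = ((m, w) \in trace s).
Proof.
apply/mapP/idP => [[[a b]]|mt]; last by exists (m, w); rewrite ?mem_filter ?eqxx.
by rewrite mem_filter /= => /andP[/eqP-> ?] ->.
Qed.

(** These invariants read a state off the proposals made so far, so that two runs can be compared
    through their traces. *)
Record gs_reach n (Q : profile n) (s : gs_state n) : Prop := GSReach {
  reach_inv : gs_inv s;
  reach_suffix : forall m, exists c, mpref Q m = c ++ remaining s m;
  reach_rejected : forall m v, v \in mpref Q m -> v \notin remaining s m ->
    (m, v) \in trace s /\ exists2 m', (m', v) \in trace s & prefers Q v m' m;
  reach_best : forall v m, partner s v = Some m ->
    (m, v) \in trace s /\ forall m', (m', v) \in trace s -> ~~ prefers Q v m' m;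
  reach_taken : forall m v, (m, v) \in trace s -> partner s v <> None }.

Lemma prefers_total n (Q : profile n) w m m' :
  strategy Q -> m != m' -> ~~ prefers Q w m m' -> prefers Q w m' m.
Proof.
case=> _ cw nm; rewrite /prefers -leqNgt leq_eqVlt => /orP[|//] /eqP e.
have /(congr1 (nth m (wpref Q w))) := e.
rewrite !nth_index ?(complete_mem _ (cw w)) // => E.
by rewrite E eqxx in nm.
Qed.

Lemma gs_reach_at n (Q : profile n) k : strategy Q -> gs_reach Q (gs_at Q k).
Proof.
move=> sQ; have [cm cw] := sQ; elim: k => [|k IH].
  split=> [|m|m v|v m|] //=.
  - split=> [m|v m|m v] /=; [exact: complete_uniq| by rewrite ffunE| by rewrite complete_mem].
  - by exists [::].
  - by move=> ->.
  - by rewrite ffunE.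
have -> : gs_at Q k.+1 = gs_step Q (gs_at Q k) by [].
have [I' _] := gs_step_inv Q (reach_inv IH); case: IH I'.
set s := gs_at Q k => I su re be ta.
have nm m v : single s m -> partner s v <> Some m.
  by move/forallP => /(_ v) /eqP.
have [_ hd _] := I.
case: (gs_stepP Q s) => [|m v r sm er ep|m v r m' sm er ep pr|m v r m' sm er ep pr] I'.
- by split.
- split=> //= [a b ba bn|b a|a b].
  + have [at_ [m' m't ?]] := re _ _ ba bn.
    by split; last exists m'; rewrite // mem_rcons inE ?at_ ?m't orbT.
  + rewrite ffunE; case: eqP => [->[<-]|nb /be[at_ ba]].
      rewrite mem_rcons inE eqxx; split=> // m'.
      rewrite mem_rcons inE xpair_eqE eqxx andbT => /orP[/eqP->|/ta//].
      by rewrite /prefers ltnn.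
    rewrite mem_rcons inE at_ orbT; split=> // m'.
    by rewrite mem_rcons inE xpair_eqE => /orP[/andP[_ /eqP]//|/ba].
  + rewrite mem_rcons inE xpair_eqE ffunE => /orP[/andP[_ ->]//|/ta].
    by case: ifP.
- have [m't m'b] := be _ _ ep.
  have hm' := hd _ _ ep.
  split=> //= [a|a b|b a|a b].
  + rewrite ffunE; case: eqP => [->|_]; last exact: su.
    (* [v] heads the remaining list of [m'], so [rem] cuts off the head and leaves a suffix. *)
    have [c ->] := su m'; case: (remaining s m') hm' => //= _ l [->].
    by rewrite eqxx; exists (rcons c v); rewrite cat_rcons.
  + move=> ba; rewrite ffunE.
    (* Only the pair just deleted needs a new witness; the preferred rival is the proposer [m]. *)
    case: (boolP ((a == m') && (b == v))) => [/andP[/eqP-> /eqP->] _|nab].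
      by rewrite !mem_rcons !inE m't orbT; split=> //; exists m => //; rewrite mem_rcons inE eqxx.
    move=> bn; have bs : b \notin remaining s a.
      move: bn; case: eqP nab => //= [->] nb; rewrite mem_rem_uniq ?inE ?nb //.
      by case: I.
    have [at_ [m1 m1t ?]] := re _ _ ba bs.
    by split; last exists m1; rewrite // mem_rcons inE ?at_ ?m1t orbT.
  + rewrite ffunE; case: eqP => [->[<-]|nb /be[at_ ba]].
      rewrite mem_rcons inE eqxx; split=> // m1.
      rewrite mem_rcons inE xpair_eqE eqxx andbT => /orP[/eqP->|/m'b].
        by rewrite /prefers ltnn.
      by move: pr; rewrite /prefers; lia.
    rewrite mem_rcons inE at_ orbT; split=> // m1.
    by rewrite mem_rcons inE xpair_eqE => /orP[/andP[_ /eqP]//|/ba].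
  + rewrite mem_rcons inE xpair_eqE ffunE => /orP[/andP[_ ->]//|/ta].
    by case: ifP.
have [m't m'b] := be _ _ ep.
have mm' : m != m' by apply/eqP => E; case: (nm m v sm); rewrite ep E.
split=> //= [a|a b|b a|a b].
- rewrite ffunE; case: eqP => [->|_]; last exact: su.
  by have [c ->] := su m; rewrite er /= eqxx; exists (rcons c v); rewrite cat_rcons.
- move=> ba; rewrite ffunE.
  (* Here the rival is the current partner [m']: totality turns the refusal of [m] into a
     preference. *)
  case: (boolP ((a == m) && (b == v))) => [/andP[/eqP-> /eqP->] _|nab].
    rewrite !mem_rcons !inE eqxx; split=> //; exists m'; first by rewrite mem_rcons inE m't orbT.
    exact: prefers_total.
  move=> bn; have bs : b \notin remaining s a.
    move: bn; case: eqP nab => //= [->] nb; rewrite mem_rem_uniq ?inE ?nb //.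
    by case: I.
  have [at_ [m1 m1t ?]] := re _ _ ba bs.
  by split; last exists m1; rewrite // mem_rcons inE ?at_ ?m1t orbT.
- move=> ab; have [at_ ba] := be _ _ ab; rewrite mem_rcons inE at_ orbT; split=> // m1.
  rewrite mem_rcons inE => /orP[/eqP[-> E]|/ba //].
  by move: ab; rewrite E ep => -[<-].
- by rewrite mem_rcons inE => /orP[/eqP[_ ->]|/ta //]; rewrite ep.
Qed.

(** In the common list [v'] comes strictly before [v], so it cannot occur in the suffix starting at
    [v]. *)
Lemma notin_suffix (T : eqType) (a b r r' : seq T) v v' :
  uniq (a ++ v :: r) -> a ++ v :: r = b ++ v' :: r' -> v \in v' :: r' ->
  v != v' -> v' \notin v :: r.
Proof.
move=> u e vr nv; apply/negP => v'r.
have idx x (c d : seq T) : uniq (c ++ d) -> x \in d -> index x (c ++ d) = size c + index x d.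
  rewrite cat_uniq => /and3P[_ /hasPn h _] xd.
  by rewrite index_cat (negbTE (h _ xd)).
have h1 := idx v' a _ u v'r.
have h2 := idx v a (v :: r) u (mem_head _ _); rewrite index_head in h2.
rewrite e in u h1 h2.
have h3 := idx v' b (v' :: r') u (mem_head _ _); rewrite index_head in h3.
have h4 := idx v b _ u vr; rewrite /= eq_sym (negbTE nv) in h4.
by lia.
Qed.

Lemma mem_prefix (T : eqType) (s t : seq T) : prefix s t -> {subset s <= t}.
Proof. by move=> /prefixP[u ->] x xs; rewrite mem_cat xs. Qed.

Lemma prefix_rconsE (T : eqType) (s t : seq T) x :
  prefix s (rcons t x) = prefix s t || (s == rcons t x).
Proof.
apply/idP/orP => [/prefixP[u]|[/prefix_trans|/eqP->]]; last exact: prefix_refl.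
  elim/last_ind: u => [|u y _]; first by rewrite cats0 => ->; right.
  rewrite -rcons_cat => /eqP; rewrite eqseq_rcons => /andP[/eqP-> _].
  by left; apply: prefix_prefix.
by apply; apply: prefix_rcons.
Qed.

(** * Runs that differ only in the list of [w] *)

Section TwoLists.

Variables (n : nat) (Q : profile n) (w : 'I_n).
Hypothesis sQ : strategy Q.

Lemma replace_strategy l : complete l -> strategy (replace Q w l).
Proof. by case: sQ => cm cw cl; split=> //= v; rewrite ffunE; case: ifP. Qed.

Lemma prefers_replace l m m' :
  prefers (replace Q w l) w m m' = (index m l < index m' l).
Proof. by rewrite /prefers /= ffunE eqxx. Qed.

Lemma prefers_replaceN l l' v m m' : v != w ->
  prefers (replace Q w l) v m m' = prefers (replace Q w l') v m m'.
Proof. by move=> nv; rewrite /prefers /= !ffunE (negbTE nv). Qed.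

Definition agree_on (s l l' : seq 'I_n) :=
  {in s &, forall a b, (index a l < index b l) = (index a l' < index b l')}.

(** Proposer and woman are determined before any woman's list is read, so the new proposal is the
    same. The reaction of [w] compares the proposer with her partner, and both have proposed to her
    by then. *)
Lemma gs_step_agree l l' s : gs_reach (replace Q w l) s ->
  let s1 := gs_step (replace Q w l) s in
  let s2 := gs_step (replace Q w l') s in
  trace s1 = trace s2 /\ (agree_on (proposals_to w s1) l l' -> s1 = s2).
Proof.
move=> R; rewrite /gs_step; case: [seq _ <- _ | _] => [//|m _].
case: (remaining s m) => [//|v r].
case ep: (partner s v) => [m'|//]; split; first by do 2!case: ifP.
move=> ag; suff -> : prefers (replace Q w l) v m m' = prefers (replace Q w l') v m m' by [].
have [E|nv] := eqVneq v w; last exact: prefers_replaceN.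
rewrite E !prefers_replace; apply: ag; rewrite mem_proposals.
  by case: ifP => _; rewrite /= mem_rcons inE E eqxx.
have [m't _] := reach_best R ep.
by case: ifP => _; rewrite /= mem_rcons inE -E m't orbT.
Qed.

Lemma gs_at_agree l l' k : complete l ->
  agree_on (proposals_to w (gs_at (replace Q w l) k)) l l' ->
  gs_at (replace Q w l) k = gs_at (replace Q w l') k.
Proof.
move=> cl; elim: k => [//|k IH] ag.
have {}IH : gs_at (replace Q w l) k = gs_at (replace Q w l') k.
  apply: IH => a b ai bi; apply: ag.
    by apply: (mem_prefix (prefix_proposals _ w (leqnSn k))).
  by apply: (mem_prefix (prefix_proposals _ w (leqnSn k))).
have [_] := gs_step_agree l' (gs_reach_at k (replace_strategy cl)).
by move=> /(_ ag); rewrite [in RHS]IH.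
Qed.

Lemma proposals_at Q1 q x k :
  prefix (rcons q x) (proposals_to w (gs_at (Q1 : profile n) k)) ->
  exists j, [/\ j < k, proposals_to w (gs_at Q1 j) = q
              & proposals_to w (gs_at Q1 j.+1) = rcons q x].
Proof.
elim: k => [|k IH]; first by case: q.
have := trace_step Q1 (gs_at Q1 k); rewrite -/(gs_at Q1 k.+1) => T pq.
have : prefix (rcons q x) (proposals_to w (gs_at Q1 k)) \/
    proposals_to w (gs_at Q1 k) = q /\ proposals_to w (gs_at Q1 k.+1) = rcons q x.
  case: T => [e|[m [v [r [e _ _]]]]]; first by left; move: pq; rewrite /proposals_to e.
  move: pq; have -> : proposals_to w (gs_at Q1 k.+1) =
      if v == w then rcons (proposals_to w (gs_at Q1 k)) m else proposals_to w (gs_at Q1 k).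
    by rewrite /proposals_to e filter_rcons /=; case: ifP => // _; rewrite map_rcons.
  case: ifP => _; last by left.
  rewrite prefix_rconsE eqseq_rcons => /orP[|/andP[/eqP-> /eqP->]]; first by left.
  by right.
case=> [/IH[j [jk e1 e2]]|[e1 e2]]; first by exists j; split=> //; exact: ltnW.
by exists k.
Qed.

(** The runs coincide until [x] proposes, and he does so before [w] compares him with anyone; hence
    agreement on [q] suffices. *)
Lemma prefix_proposers l l' q x : complete l -> agree_on q l l' ->
  prefix (rcons q x) (proposers (replace Q w l) w) ->
  prefix (rcons q x) (proposers (replace Q w l') w).
Proof.
move=> cl ag /proposals_at[j [jn e1 e2]].
rewrite -e1 in ag; have E := gs_at_agree cl ag.
have [te _] := gs_step_agree l' (gs_reach_at j (replace_strategy cl)).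
apply: prefix_trans (prefix_proposals _ w jn).
by rewrite /proposals_to [gs_at _ _]/= -/(gs_at _ j) -E -te -e2 prefix_refl.
Qed.

Lemma gs_reach_gs Q1 : strategy Q1 -> gs_reach Q1 (gs (Q1 : profile n)).
Proof. exact: gs_reach_at. Qed.

(* Consider the first proposal [(m, v)] of the first run missing in the second
   one, and the final partner [v'] of [m] in the second run: in the first run
   [v'] had already rejected [m] for a man who also proposes to [v'] in the
   second run; hence [v' = w], whose partners never reject the top man [x]. *)
Lemma trace_top_sub x t t' :
  complete (x :: t) -> complete (x :: t') ->
  x \in proposers (replace Q w (x :: t')) w ->
  {subset trace (gs (replace Q w (x :: t))) <= trace (gs (replace Q w (x :: t')))}.
Proof.
move=> ct ct'; set Q1 := replace Q w (x :: t); set Q2 := replace Q w (x :: t').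
rewrite mem_proposals => xp.
have s1 : strategy Q1 := replace_strategy ct.
have s2 : strategy Q2 := replace_strategy ct'.
have R2 := gs_reach_gs s2.
suff H k : {subset trace (gs_at Q1 k) <= trace (gs Q2)} by exact: H.
elim: k => [//|k IH].
have := trace_step Q1 (gs_at Q1 k); rewrite -/(gs_at Q1 k.+1).
case=> [->//|[m [v [r [-> sm er]]]] p]; rewrite mem_rcons inE => /orP[/eqP->|/IH//].
have R1 := gs_reach_at k s1.
apply/negP => /negP mv.
have /singlePn[v' pv'] := gs_no_single m s2.
have [mv' best] := reach_best R2 pv'.
have nv : v != v' by apply: contraNneq mv => ->.
have vm : v \in mpref Q m by apply: complete_mem; case: sQ.
have vr : v \in remaining (gs Q2) m.
  by apply: contraNT mv => /(reach_rejected R2 vm)[].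
have [_ /(_ _ _ pv') hd _] := reach_inv R2.
have [a ea] := reach_suffix R1 m; have [b eb] := reach_suffix R2 m.
rewrite er in ea.
(* In the list of [m], [v'] precedes [v]: the second run still has [v] behind the head [v']. So [v']
   is already deleted when [v] heads the list in the first run. *)
have : v' \notin remaining (gs_at Q1 k) m.
  case er2: (remaining (gs Q2) m) hd => [//|v1 r2] /= [E]; subst v1.
  rewrite er; apply: (@notin_suffix _ a b r r2) => //; last by rewrite -er2.
    by rewrite -ea; apply: complete_uniq; case: sQ.
  by rewrite -ea -er2 -eb.
have v'm : v' \in mpref Q m by apply: complete_mem; case: sQ.
case/(reach_rejected R1 v'm) => _ [m1 m1t pr].
have nb := best _ (IH _ m1t).
have [E|nw] := eqVneq v' w; last by move: nb; rewrite (prefers_replaceN _ (x :: t)) // pr.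
(* The final partner [m] of [w] must be [x], who proposes and heads her list; but nobody is
   preferred to [x]. *)
subst v'; move: pr (best _ xp); rewrite !prefers_replace /= eqxx.
by case: (x =P m).
Qed.

Lemma mu_top x t : complete (x :: t) ->
  x \in proposers (replace Q w (x :: t)) w ->
  mu (replace Q w (x :: t)) w = Some x.
Proof.
move=> ct; rewrite mem_proposals => xp.
have R := gs_reach_gs (replace_strategy ct).
case e: (mu _ w) => [m|]; last by case: (reach_taken R xp).
have [_ /(_ _ xp)] := reach_best R e.
by rewrite prefers_replace /= eqxx; case: (x =P m) => // ->.
Qed.

Lemma mu_proposer l m : complete l ->
  mu (replace Q w l) w = Some m -> m \in proposers (replace Q w l) w.
Proof.
move=> cl e; rewrite mem_proposals.
by have [] := reach_best (gs_reach_gs (replace_strategy cl)) e.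
Qed.

End TwoLists.

(** * Moving a man to the front of a list *)

Lemma index_move_front (T : eqType) (l : seq T) y a b : a != y -> b != y ->
  (index a l < index b l) = (index a (y :: rem y l) < index b (y :: rem y l)).
Proof.
move=> ay yb; rewrite /= !(eq_sym y) (negbTE ay) (negbTE yb) ltnS.
elim: l => //= c l IH; have [->|cy] := eqVneq c y.
  by rewrite !(eq_sym y) (negbTE ay) (negbTE yb).
by rewrite /=; case: (c =P a); case: (c =P b).
Qed.

Lemma complete_move_front n (l : seq 'I_n) y : complete l -> complete (y :: rem y l).
Proof.
move=> cl; apply: perm_trans (cl); rewrite perm_sym.
exact: perm_to_rem (complete_mem y cl).
Qed.

Lemma complete_to_front n (Q : profile n) w I : complete (wpref Q w) -> uniq I ->
  complete (to_front Q w I).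
Proof.
move=> cw uI; apply: uniq_perm (enum_uniq _) _.
  rewrite cat_uniq uI filter_uniq ?(complete_uniq cw) // andbT.
  by apply/hasPn => z; rewrite mem_filter => /andP[].
by move=> z; rewrite mem_cat mem_filter mem_enum (complete_mem z cw) andbT orbN.
Qed.

Lemma to_front_cons n (Q : profile n) w y I : complete (wpref Q w) ->
  uniq (y :: I) -> to_front Q w (y :: I) = y :: rem y (to_front Q w I).
Proof.
move=> cw /andP[yI uI]; rewrite rem_filter; last exact/complete_uniq/complete_to_front.
rewrite /to_front /= filter_cat -filter_predI; congr (_ :: _ ++ _).
  by apply/esym/all_filterP/allP => z; apply: contraTneq => ->.
by apply: eq_filter => z; rewrite /= inE negb_or.
Qed.

Lemma mem_rcons_last (T : eqType) (s : seq T) x : x \in rcons s x.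
Proof. by rewrite mem_rcons mem_head. Qed.

Lemma mem_split_index (T : eqType) (p : seq T) x z : z \in p ->
  [\/ z \in take (index x p) p, z = x | z \in drop (index x p).+1 p].
Proof.
elim: p => //= c p IH; rewrite inE; have [->|_] := eqVneq c x.
  by rewrite drop0 => /orP[/eqP->|]; [exact: Or32 | exact: Or33].
case/orP=> [/eqP->|/IH[zt|->|zd]]; last exact: Or33.
- by apply: Or31; rewrite inE eqxx.
- by apply: Or31; rewrite inE zt orbT.
- exact: Or32.
Qed.

Lemma prefix_index_take (T : eqType) (p : seq T) x :
  x \in p -> prefix (rcons (take (index x p) p) x) p.
Proof.
move=> xp; apply/prefixP; exists (drop (index x p).+1 p).
by rewrite cat_rcons -{2}(nth_index x xp) -drop_nth ?index_mem // cat_take_drop.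
Qed.

Lemma take_index_prefix (T : eqType) (p q : seq T) x :
  x \notin q -> prefix (rcons q x) p -> take (index x p) p = q.
Proof.
move=> xq /prefixP[u ->]; rewrite cat_rcons index_cat (negbTE xq) /= eqxx addn0.
by rewrite take_size_cat.
Qed.

Lemma notin_take_index (T : eqType) (p : seq T) x : x \notin take (index x p) p.
Proof.
elim: p => //= c p IH; case: (eqVneq c x) => [->//|cx].
by rewrite /= inE eq_sym negb_or cx.
Qed.

(** * The pairs visited by the exploration *)

Section Explore.

Variables (n : nat) (Q : profile n) (w x1 : 'I_n) (order : seq 'I_n -> seq 'I_n).
Hypothesis sQ : strategy Q.
Hypothesis order_complete : forall J, complete (order J).

Let cw : complete (wpref Q w).
Proof. by case: sQ. Qed.

Local Notation front I := (replace Q w (to_front Q w I)).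

(** Moving [y] keeps the relative order of the men in [q], so the run is unchanged up to his
    proposal. *)
Lemma proposers_move_front I y q : uniq (y :: I) -> y \notin q ->
  prefix (rcons q y) (proposers (front I) w) ->
  prefix (rcons q y) (proposers (front (y :: I)) w).
Proof.
move=> uJ yq; apply: prefix_proposers => //.
  by apply: complete_to_front => //; case/andP: uJ.
move=> a b aq bq; rewrite to_front_cons //; apply: index_move_front.
  by apply: contraNneq yq => <-.
by apply: contraNneq yq => <-.
Qed.

(* [T] lists the pairs [(y, I)] such that [Q(y, I; w)] has been put in [L]. *)
Record explored (T : seq ('I_n * seq 'I_n)) (NL : output n) : Prop := Explored {
  explored_uniq : uniq (unzip1 T);
  explored_men : NL.1 =i unzip1 T;
  explored_lists : NL.2 = [seq to_front Q w (p.1 :: p.2) | p <- T];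
  explored_tuple : forall p, p \in T ->
    uniq (p.1 :: p.2) /\ {subset p.1 :: p.2 <= NL.1};
  explored_origin : forall p, p \in T -> p = (x1, [::]) \/
    exists2 p', p' \in T & p.2 = p'.1 :: p'.2 /\ p.1 \in later_proposers Q w p.2 }.

(** Holds for a pair once its call of [explore] is finished. *)
Definition closed_in (N : {set 'I_n}) (p : 'I_n * seq 'I_n) :=
  {subset later_proposers Q w (p.1 :: p.2) <= N}.

(** Induction on the fuel, with an inner induction on the men the call goes through. [T'] collects
    the pairs added during the call; their own calls are finished too, while older pairs of [T] may
    still be in progress. *)
Lemma explore_explored k p T NL :
  n < k + size (p.1 :: p.2) -> p \in T -> explored T NL ->
  let NL' := explore order Q w k (p.1 :: p.2) NL in
  exists2 T', explored (T' ++ T) NL' & forall p', p' \in p :: T' -> closed_in NL'.1 p'.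
Proof.
elim: k p T NL => [|k IH] p T NL lt pT E.
  have [u _] := explored_tuple E pT.
  (* A tuple of distinct men has at most [n] entries, so the fuel is never exhausted. *)
  have := max_card (mem (p.1 :: p.2)); rewrite (card_uniqP u) card_ord => le.
  by rewrite add0n ltnNge le in lt.
set J := p.1 :: p.2; move=> NL'.
(* [order J] contains every man, so the filtered list misses no later proposer. *)
suff : exists2 T', explored (T' ++ T) NL' &
    {subset [seq y <- order J | y \in later_proposers Q w J] <= NL'.1} /\
    forall p', p' \in T' -> closed_in NL'.1 p'.
  case=> T' ET [sub cl]; exists T' => // p'; rewrite inE => /orP[/eqP->|/cl//].
  by move=> z zl; apply: sub; rewrite mem_filter zl complete_mem.
rewrite {}/NL' /=.
have : {subset [seq y <- order J | y \in later_proposers Q w J]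
    <= later_proposers Q w J}.
  by move=> z; rewrite mem_filter => /andP[].
elim: [seq _ <- _ | _] T NL pT E => [|y s IHs] T NL pT E sl /=; first by exists [::].
have sl' : {subset s <= later_proposers Q w J}.
  by move=> z zs; apply: sl; rewrite inE zs orbT.
(* The set of men only grows, so closedness survives later calls. *)
have mono T1 (NL1 NL2 : output n) T2 : explored T1 NL1 -> explored (T2 ++ T1) NL2 ->
    {subset NL1.1 <= NL2.1}.
  move=> E1 E2 z; rewrite (explored_men E1) (explored_men E2) /unzip1 map_cat mem_cat => ->.
  by rewrite orbT.
case: ifPn => yN.
  have [T' ET [sub cl]] := IHs T NL pT E sl'; exists T' => //; split=> // z.
  by rewrite inE => /orP[/eqP->|/sub//]; exact: (mono _ _ _ _ E ET).
have [uJ sJ] := explored_tuple E pT.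
have yJ : y \notin J by apply: contra yN; exact: sJ.
have E1 : explored ((y, J) :: T) (y |: NL.1, to_front Q w (y :: J) :: NL.2).
  split=> /=.
  - by rewrite -(explored_men E) yN (explored_uniq E).
  - by move=> z; rewrite !inE (explored_men E).
  - by rewrite (explored_lists E).
  - move=> p'; rewrite inE => /orP[/eqP->|p'T].
      split=> [|z]; first exact/andP.
      by rewrite !in_setU1 inE => /orP[->//|/sJ->]; rewrite orbT.
    have [? sub] := explored_tuple E p'T; split=> // z /sub.
    by rewrite in_setU1 => ->; rewrite orbT.
  - move=> p'; rewrite inE => /orP[/eqP->|p'T].
      right; exists p; first by rewrite inE pT orbT.
      by split=> //; apply: sl; rewrite mem_head.
    case: (explored_origin E p'T) => [->|[p'' ? ?]]; [by left | right; exists p'' => //].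
    by rewrite inE; apply/orP; right.
have lt1 : n < k + size (y :: J) by rewrite /= addnS -addSn.
have [T1 ET1 cl1] := IH (y, J) _ _ lt1 (mem_head _ _) E1.
set NL1 := explore _ _ _ _ _ _ in ET1 cl1 *.
have pT1 : p \in T1 ++ (y, J) :: T by rewrite mem_cat inE pT !orbT.
have [T2 ET2 [sub cl2]] := IHs _ _ pT1 ET1 sl'.
exists (T2 ++ rcons T1 (y, J)); first by rewrite -catA cat_rcons.
have sub12 := mono _ _ _ _ ET1 ET2.
split=> [z|p'].
  rewrite inE => /orP[/eqP->|/sub//]; apply: sub12.
  by rewrite (explored_men ET1) /unzip1 map_cat mem_cat /= inE eqxx orbT.
rewrite mem_cat mem_rcons => /orP[/cl2//|/cl1 cp'] z /cp'; exact: sub12.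
Qed.

Lemma to_front_nil : to_front Q w [::] = wpref Q w.
Proof. by rewrite /to_front /= filter_predT. Qed.

Lemma replace_front_nil : front [::] = Q.
Proof.
rewrite to_front_nil; case: Q => f g; congr Profile.
by apply/ffunP => v; rewrite ffunE /=; case: eqP => [->|].
Qed.

(** * Explored men propose, and nobody else ever does *)

Variable p1 : seq 'I_n.
Hypothesis first_proposer : proposers Q w = x1 :: p1.

(** On the list for [(y, I)], the men proposing before [y] form [q], and those after him are covered
    by [closed_in]. *)
Lemma closed_proposers (N : {set 'I_n}) y I q : uniq (y :: I) -> y \in N ->
  y \notin q -> {subset q <= N} -> prefix (rcons q y) (proposers (front I) w) ->
  closed_in N (y, I) ->
  [/\ y \in proposers (front I) w, y \in proposers (front (y :: I)) w
    & {subset proposers (front (y :: I)) w <= N}].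
Proof.
move=> uJ yN yq qN pq cl; have pq' := proposers_move_front uJ yq pq.
split=> [||z].
- exact: (mem_prefix pq (mem_rcons_last _ _)).
- exact: (mem_prefix pq' (mem_rcons_last _ _)).
move=> /(mem_split_index y)[|->//|/cl//].
by rewrite (take_index_prefix yq pq'); exact: qN.
Qed.

(** Induction on the tuple: [y] was found in the run for [(y0, I)], whose proposers are already in
    the set. At the root, [x1] proposes first on [Q] itself. *)
Lemma explored_proposers T NL y I : explored T NL ->
  (forall p, p \in T -> closed_in NL.1 p) -> (y, I) \in T ->
  [/\ y \in proposers (front I) w, y \in proposers (front (y :: I)) w
    & {subset proposers (front (y :: I)) w <= NL.1}].
Proof.
move=> E cl.
elim: I y => [|y0 I IH] y yIT; have [uJ sJ] := explored_tuple E yIT.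
  case: (explored_origin E yIT) => [[Ey]|[p' _ [//]]].
  apply: (@closed_proposers _ _ _ [::]) (cl _ yIT) => //; first by rewrite sJ ?mem_head.
  by rewrite replace_front_nil first_proposer Ey /= eqxx prefix0s.
case: (explored_origin E yIT) => [//|[[a b] p'T /= [[Ea Eb] ylat]]]; subst a b.
have [_ _ pN] := IH _ p'T.
pose p := proposers (front (y0 :: I)) w.
apply: (@closed_proposers _ _ _ (take (index y p) p)) (cl _ yIT) => //.
- by rewrite sJ ?mem_head.
- exact: notin_take_index.
- by move=> z /mem_take; exact: pN.
- by apply: prefix_index_take; exact: mem_drop ylat.
Qed.

(* Moving the best [x] among the men [q] having proposed so far to the front of
   [l] leaves the run unchanged until the next proposal [z]; the set of
   proposals then no longer depends on the rest of the list, so [z] also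
   proposes in the run on [Q(x, I; w)] for the pair [(x, I)] in [T]. *)
Lemma explored_complete T NL l : explored T NL ->
  (forall p, p \in T -> closed_in NL.1 p) -> x1 \in NL.1 -> complete l ->
  {subset proposers (replace Q w l) w <= NL.1}.
Proof.
move=> E cl x1N cpl.
suff H q : prefix q (proposers (replace Q w l) w) -> {subset q <= NL.1}.
  by apply: H; exact: prefix_refl.
elim/last_ind: q => [//|q z IH] pz.
have {}IH : {subset q <= NL.1} by apply: IH; exact: prefix_trans (prefix_rcons q z) pz.
suff zN : z \in NL.1 by move=> m; rewrite mem_rcons inE => /orP[/eqP->//|/IH].
case: q IH pz => [_|a q IH] pz.
  (* The first proposal to [w] precedes any comparison by her, so it is that of [x1]. *)
  have : prefix [:: z] (proposers (front [::]) w) by apply: prefix_proposers pz.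
  by rewrite replace_front_nil first_proposer /= prefix0s andbT => /eqP->.
have [x xq xmin] := @arg_minnP _ a (mem (a :: q)) (fun b => index b l) (mem_head _ _).
have := IH x xq; rewrite (explored_men E) => /mapP[[x' I] xIT /= Ex]; subst x'.
have [_ xp pN] := explored_proposers E cl xIT.
have cpl' := complete_move_front x cpl.
have pz' : prefix (rcons (a :: q) z) (proposers (replace Q w (x :: rem x l)) w).
  apply: prefix_proposers pz => // b c bq cq.
  (* Comparisons with [x] are preserved because he comes first among these men on both lists. *)
  have [->|bx] := eqVneq b x; last first.
    have [->|cx] := eqVneq c x; last exact: index_move_front.
    by rewrite ltnNge xmin //= eqxx ltn0.
  have [->|cx] := eqVneq c x; first by rewrite !ltnn.
  rewrite /= eqxx eq_sym (negbTE cx) ltn_neqAle xmin // andbT ltnS leq0n.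
  apply: contraNneq cx => /(congr1 (nth x l)).
  by rewrite !nth_index ?(complete_mem _ cpl) // => ->.
apply: pN; rewrite mem_proposals; pose t' := I ++ [seq m <- wpref Q w | m \notin x :: I].
apply: (trace_top_sub sQ (t' := t') cpl') => //.
  by apply: (@complete_to_front _ _ _ (x :: I) cw); have [] := explored_tuple E xIT.
by have := mem_prefix pz' (mem_rcons_last _ _); rewrite mem_proposals.
Qed.

End Explore.

Theorem theorem1 (n : nat) (Q : profile n) (w : 'I_n)
    (order : seq 'I_n -> seq 'I_n) (hQ : strategy Q)
    (horder : forall J : seq 'I_n, complete (order J)) :
  let N := (algoA order Q w).1 in
  let L := (algoA order Q w).2 in
  (forall m : 'I_n,
      m \in N <-> exists Q' : profile n, strat_family Q w Q' /\ mu Q' w = Some m) /\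
  (exists I : 'I_n -> seq 'I_n,
      (forall m : 'I_n, m \in N ->
          uniq (m :: I m) /\ active Q w (to_front Q w (I m)) m) /\
      L =i [seq to_front Q w (m :: I m) | m in N]).
Proof.
rewrite /algoA /algoA_fuel; have cw : complete (wpref Q w) by case: hQ.
case ep: (proposers Q w) => [|x1 p1].
  split=> [m|]; last first.
    exists (fun _ => [::]); split=> [m|z]; first by rewrite inE.
    by apply/esym/negP => /mapP[m]; rewrite mem_enum inE.
  split=> [|[_ [[l cl ->]] /(mu_proposer hQ cl) mp]]; first by rewrite inE.
  (* The first proposal to [w] does not depend on her list, so it would also occur on [Q]. *)
  case ez: (proposers (replace Q w l) w) mp => [//|z q] _.
  have : prefix (rcons [::] z) (proposers (replace Q w (to_front Q w [::])) w).
    by apply: (prefix_proposers hQ cl) => //; rewrite ez /= eqxx prefix0s.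
  by rewrite replace_front_nil ep.
have E0 : explored Q w x1 [:: (x1, [::])] ([set x1], [:: to_front Q w [:: x1]]).
  split=> //= [m|p|p]; rewrite ?inE //= => /eqP->; last by left.
  by split=> // z; rewrite !inE.
have [|T0 ET cl] := explore_explored horder _ (mem_head _ _) E0 (k := n).
  by rewrite addn1.
set NL := explore _ _ _ _ _ _ in ET cl *.
set T := T0 ++ _ in ET.
have {}cl p : p \in T -> closed_in Q w NL.1 p.
  by rewrite mem_cat mem_seq1 => /orP[pT|/eqP->]; apply: cl; rewrite inE ?eqxx ?pT ?orbT.
have x1N : x1 \in NL.1 by rewrite (explored_men ET) /unzip1 map_cat mem_cat /= inE eqxx orbT.
have NP m : m \in NL.1 -> exists I, (m, I) \in T.
  by rewrite (explored_men ET) => /mapP[[a I] aT ->]; exists I.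
split=> [m|].
  split=> [/NP[I mT]|[_ [[l cpl ->]] /(mu_proposer hQ cpl)]]; last first.
    exact: (explored_complete hQ ep ET cl x1N cpl).
  have [_ mp _] := explored_proposers hQ ep ET cl mT.
  have cmp : complete (to_front Q w (m :: I)).
    by apply: complete_to_front => //; have [] := explored_tuple ET mT.
  exists (replace Q w (to_front Q w (m :: I))); split.
    by exists (to_front Q w (m :: I)).
  exact: mu_top.
(* Each man occurs once in [T], so his tuple is well defined; [[::]] is the default for men outside
   [N]. *)
pose I m := nth [::] (unzip2 T) (index m (unzip1 T)).
have IE p : p \in T -> I p.1 = p.2.
  move=> pT; pose i := index p T.
  have iT : i < size T by rewrite index_mem.
  have <- : nth p T i = p by rewrite nth_index.
  rewrite /I -(nth_map p p.1 fst) // index_uniq ?size_map ?(explored_uniq ET) //.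
  by rewrite (nth_map p).
exists I; split=> [m /NP[J mT]|l].
  have := IE _ mT => /= ->; split; first by have [] := explored_tuple ET mT.
  by have [] := explored_proposers hQ ep ET cl mT.
rewrite (explored_lists ET); apply/mapP/mapP => [[p pT ->]|[m]].
  exists p.1; last by rewrite IE.
  by rewrite mem_enum (explored_men ET) map_f.
rewrite mem_enum => /NP[J mT] ->; exists (m, J) => //.
by have := IE _ mT => /= ->.
Qed.
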